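(* Let $A:\mathcal{H}_1\to\mathcal{H}_2$ be a nonzero bounded linear operator between real Hilbert spaces, let $T:\mathcal{H}_2\to\mathcal{H}_2$ be $\rho$-SQNE, where $\rho\ge 0$, and let $S\subseteq\mathcal{H}_2$ be nonempty. Assume that $\operatorname{im}A\cap\operatorname{Fix}T\neq\emptyset$. Let $\mathcal{L}\{T\}:\mathcal{H}_1\to\mathcal{H}_1$ be the Landweber operator corresponding to $T$. Then the following statements hold. (i) If $T$ is weakly regular over $S$, then $\mathcal{L}\{T\}$ is weakly regular over $A^{-1}(S)$. (ii) If $\operatorname{im}A$ is closed, $T$ is regular over $S$, $S$ is bounded and the family $\{\operatorname{im}A,\operatorname{Fix}T\}$ is regular over $S$, then $\mathcal{L}\{T\}$ is regular over $A^{-1}(S)$. (iii) If $\operatorname{im}A$ is closed, $T$ is linearly regular with modulus $\delta>0$ over $S$ and the family $\{\operatorname{im}A,\operatorname{Fix}T\}$ is linearly regular with modulus $\kappa>0$ over $S$, then $\mathcal{L}\{T\}$ is linearly regular over $A^{-1}(S)$ with modulus $$\Delta:=\frac{\rho+1}{2}\left(\frac{\delta|A|}{\kappa\|A\|}\right)^2,$$ that is, for any $x\in A^{-1}(S)$, $$\|\mathcal{L}\{T\}x-x\|\ge\frac{\rho+1}{2}\left(\frac{\delta|A|}{\kappa\|A\|}\right)^2 d\big(x,\operatorname{Fix}\mathcal{L}\{T\}\big).$$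
   Context: $\mathcal{H}_1,\mathcal{H}_2$ are real Hilbert spaces; $A^*$ is the adjoint of $A$, $\operatorname{im}A$ its image, $\|A\|$ its operator norm, and $|A|:=\inf\{\|Ax\| : x\in(\ker A)^\perp,\ \|x\|=1\}$. $\operatorname{Fix}T$ is the fixed point set of $T$, $d(x,C)=\inf_{c\in C}\|x-c\|$, and $\rightharpoonup$ denotes weak convergence. Landweber operator: $\mathcal{L}\{T\}x:=x+\frac{1}{\|A\|^2}A^*(T(Ax)-Ax)$ for $x\in\mathcal{H}_1$. $\rho$-SQNE ($\rho$-strongly quasi-nonexpansive, $\rho\ge 0$): $T$ (not necessarily linear) has $\operatorname{Fix}T\ne\emptyset$ and $\|Tx-z\|^2\le\|x-z\|^2-\rho\|Tx-x\|^2$ for all $x$ and all $z\in\operatorname{Fix}T$. Regular operators. An operator $U$ on a Hilbert space $\mathcal{H}$ with $\operatorname{Fix}U\neq\emptyset$ is, over a set $S\subseteq\mathcal{H}$: - weakly regular if for any sequence $\{x_k\}\subseteq S$ and any $x_\infty\in\mathcal{H}$, whenever a subsequence $x_{n_k}\rightharpoonup x_\infty$ and $Ux_k-x_k\to0$ then $x_\infty\in\operatorname{Fix}U$; - regular if for any sequence $\{x_k\}\subseteq S$, $\|Ux_k-x_k\|\to0$ implies $d(x_k,\operatorname{Fix}U)\to0$; - linearly regular with modulus $\delta>0$ if $\|Ux-x\|\ge\delta\, d(x,\operatorname{Fix}U)$ for every $x\in S$. Regular families of sets. A family $\{C_1,\dots,C_m\}$ of closed convex sets with $C:=\bigcap_iC_i\neq\emptyset$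 is, over a set $S$: - regular if for any sequence $\{x_k\}\subseteq S$, $\max_i d(x_k,C_i)\to0$ implies $d(x_k,C)\to0$; - linearly regular with modulus $\kappa>0$ if $d(x,C)\le\kappa\max_i d(x,C_i)$ for every $x\in S$. *)

(* Defs.v *)
From HB Require Import structures.
From mathcomp Require Export all_boot all_order all_algebra.
From mathcomp Require Export all_classical all_reals all_analysis.

Set Implicit Arguments.
Unset Strict Implicit.
Unset Printing Implicit Defensive.

Export Order.TTheory GRing.Theory Num.Theory.
Export numFieldNormedType.Exports.

#[export] Set Warnings "-notation-overridden,-ambiguous-paths".

Local Open Scope classical_set_scope.
Local Open Scope ring_scope.

(* A real Hilbert space is a complete normed module whose norm comes from a
   positive definite symmetric bilinear form. *)
HB.mixin Record CompleteNormedModule_isHilbert (R : realType) H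
    & CompleteNormedModule R H := {
  inner : {dot H for idfun} ;
  innerxx : forall x : H, inner x x = `|x| ^+ 2
}.

#[short(type="hilbertType")]
HB.structure Definition Hilbert (R : realType) :=
  {H of CompleteNormedModule R H & CompleteNormedModule_isHilbert R H}.

Notation "'⟨' x , y '⟩'" := (inner x%R y%R)
  (at level 0, x at level 99, y at level 99, format "'⟨' x ,  y '⟩'")
  : ring_scope.

Section Hilbert_space.
Context {R : realType} {H : hilbertType R}.

Definition orthogonal_complement (V : set H) : set H :=
  [set x | forall v, V v -> ⟨x, v⟩ = 0].

Definition weak_cvg (x : nat -> H) (l : H) : Prop :=
  forall y : H, ⟨x n, y⟩ @[n --> \oo] --> ⟨l, y⟩.

(* [inf] is a junk value when [C] is empty; all uses are guarded by [C !=set0]. *)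
Definition dist (x : H) (C : set H) : R := inf [set `|x - c| | c in C].

Definition Fix (T : H -> H) : set H := [set x | T x = x].

Definition SQNE (rho : R) (T : H -> H) : Prop :=
  Fix T !=set0 /\
  forall x z, Fix T z ->
    `|T x - z| ^+ 2 <= `|x - z| ^+ 2 - rho * `|T x - x| ^+ 2.

Definition weakly_regular (U : H -> H) (S : set H) : Prop :=
  Fix U !=set0 /\
  forall (x : nat -> H) (n : nat -> nat) (xoo : H),
    (forall k, S (x k)) ->
    {homo n : i j / (i < j)%N} ->
    weak_cvg (x \o n) xoo ->
    U (x k) - x k @[k --> \oo] --> (0 : H) ->
    Fix U xoo.

Definition regular (U : H -> H) (S : set H) : Prop :=
  Fix U !=set0 /\
  forall x : nat -> H,
    (forall k, S (x k)) ->
    `|U (x k) - x k| @[k --> \oo] --> (0 : R) ->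
    dist (x k) (Fix U) @[k --> \oo] --> (0 : R).

Definition linearly_regular (U : H -> H) (S : set H) (delta : R) : Prop :=
  [/\ Fix U !=set0, 0 < delta &
      forall x, S x -> delta * dist x (Fix U) <= `|U x - x|].

Section families.
Context {m : nat}.
Implicit Type C : 'I_m -> set H.

Definition convex_family C : Prop :=
  (forall i, closed (C i) /\ convex_set (C i)) /\ \bigcap_i C i !=set0.

(* Distances are nonnegative, so 0 is a neutral start value for the maximum. *)
Definition max_dist (x : H) C : R := \big[Num.max/0]_(i < m) dist x (C i).

Definition regular_family C (S : set H) : Prop :=
  convex_family C /\
  forall x : nat -> H,
    (forall k, S (x k)) ->
    max_dist (x k) C @[k --> \oo] --> (0 : R) ->
    dist (x k) (\bigcap_i C i) @[k --> \oo] --> (0 : R).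

Definition linearly_regular_family C (S : set H) (kappa : R) : Prop :=
  [/\ convex_family C, 0 < kappa &
      forall x, S x -> dist x (\bigcap_i C i) <= kappa * max_dist x C].

End families.
End Hilbert_space.

Section operators.
Context {R : realType} {H1 H2 : hilbertType R}.
Implicit Type A : H1 -> H2.

Definition ker A : set H1 := [set x | A x = 0].

(* [adjoint A y] is the v such that <A x, y> = <x, v> for all x; for A bounded
   and linear it exists and is unique (Riesz), otherwise the value is junk. *)
Definition adjoint A (y : H2) : H1 :=
  xget 0 [set v : H1 | forall x, ⟨A x, y⟩ = ⟨x, v⟩].

Definition opnorm A : R := sup [set `|A x| | x in [set x | `|x| <= 1]].

Definition min_modulus A : R :=
  inf [set `|A x| | x in orthogonal_complement (ker A) `&` [set x | `|x| = 1]].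

Definition landweber A (T : H2 -> H2) (x : H1) : H1 :=
  x + (opnorm A ^+ 2)^-1 *: adjoint A (T (A x) - A x).

End operators.

(* Main.v *)
From mathcomp Require Import ring lra.
Require Import Defs.

Set Implicit Arguments.
Unset Strict Implicit.
Unset Printing Implicit Defensive.

Local Open Scope classical_set_scope.
Local Open Scope ring_scope.

(** Write [N] for the norm of [A], [L] for the Landweber operator, and [r x]
    for the residual [T (A x) - A x], so that [N ^+ 2 *: (L x - x)] is the
    adjoint of [A] applied to [r x]. Expanding the square in the SQNE
    inequality at [A x] gives, for every [w] with [A w] in [Fix T],

      (rho + 1) / 2 * `|r x| ^+ 2 <= ⟨r x, A w - A x⟩
                                   = N ^+ 2 * ⟨L x - x, w - x⟩.

    Since [range A] meets [Fix T], this shows first that [Fix L] is the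
    preimage of [Fix T] ([Fix_landweber]), and then, by Cauchy-Schwarz and an
    infimum over [w], the estimate [residual_le_dist] that carries the theorem:

      (rho + 1) / 2 * `|r x| ^+ 2 <= N ^+ 2 * `|L x - x| * dist x (Fix L).

    As long as [dist (x k) (Fix L)] stays bounded, [L (x k) - x k --> 0]
    therefore forces [r (x k) --> 0] ([residual_cvg0]).

    Statement (i): a weakly convergent subsequence is bounded by the uniform
    boundedness principle, so its residuals vanish, and weak regularity of [T]
    applies to its image under [A], which converges weakly to [A xoo].

    Statements (ii) and (iii) also need to compare [dist x (Fix L)] with
    [dist (A x) (range A `&` Fix T)], which [dist_preimage] does at the cost of
    the factor [min_modulus A]: of all points with a given image under [A], the
    one nearest to [x] differs from [x] by a vector orthogonal to [ker A].
    The factor is positive because [range A] is closed and [A] is not zero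
    ([min_modulus_gt0]). This is a consequence of the open mapping theorem, but
    uniform boundedness gives it directly: the set of the [u] in [range A]
    whose image under the adjoint has norm at most 1 is weakly bounded, hence
    bounded, so the adjoint is bounded below on [range A]
    ([adjoint_bounded_below]); by density of the range of the adjoint in the
    orthogonal complement of [ker A], so is [A] on that complement
    ([bounded_below]).

    In (ii), boundedness of [S] bounds [dist (x k) (Fix L)], and the regularity
    of [T] and of the family bring the distances to 0. In (iii) the linear
    estimates bound [`|r x|] below by a multiple of [dist x (Fix L)]; inserted
    in [residual_le_dist], one factor [dist x (Fix L)] cancels. *)

(** * Inner products *)

Section InnerProduct.
Context {R : realType} {H : hilbertType R}.
Implicit Types (x y z : H) (a : R).

Lemma innerC x y : ⟨x, y⟩ = ⟨y, x⟩.
Proof. by have := @hermC _ _ _ _ (@inner R H) x y; rewrite expr0 mul1r. Qed.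

Lemma innerDl x y z : ⟨x + y, z⟩ = ⟨x, z⟩ + ⟨y, z⟩.
Proof. exact: linearDl. Qed.

Lemma innerZl a x y : ⟨a *: x, y⟩ = a * ⟨x, y⟩.
Proof. exact: linearZl_LR. Qed.

Lemma innerDr x y z : ⟨x, y + z⟩ = ⟨x, y⟩ + ⟨x, z⟩.
Proof. by rewrite innerC innerDl ![⟨_, x⟩]innerC. Qed.

Lemma innerZr a x y : ⟨x, a *: y⟩ = a * ⟨x, y⟩.
Proof. by rewrite innerC innerZl innerC. Qed.

Lemma innerNl x y : ⟨- x, y⟩ = - ⟨x, y⟩.
Proof. by rewrite -scaleN1r innerZl mulN1r. Qed.

Lemma innerNr x y : ⟨x, - y⟩ = - ⟨x, y⟩.
Proof. by rewrite innerC innerNl innerC. Qed.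

Lemma innerBr x y z : ⟨x, y - z⟩ = ⟨x, y⟩ - ⟨x, z⟩.
Proof. by rewrite innerDr innerNr. Qed.

Lemma inner0l x : ⟨0, x⟩ = 0.
Proof. by rewrite -(scale0r 0) innerZl mul0r. Qed.

Lemma inner0r x : ⟨x, 0⟩ = 0.
Proof. by rewrite innerC inner0l. Qed.

Lemma sqr_normD x y : `|x + y| ^+ 2 = `|x| ^+ 2 + 2 * ⟨x, y⟩ + `|y| ^+ 2.
Proof.
by rewrite -!innerxx innerDl !innerDr (innerC y x); ring.
Qed.

Lemma sqr_normB x y : `|x - y| ^+ 2 = `|x| ^+ 2 - 2 * ⟨x, y⟩ + `|y| ^+ 2.
Proof. by rewrite sqr_normD normrN innerNr mulrN. Qed.

Lemma parallelogram x y :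
  `|x + y| ^+ 2 + `|x - y| ^+ 2 = 2 * `|x| ^+ 2 + 2 * `|y| ^+ 2.
Proof. by rewrite sqr_normB sqr_normD; ring. Qed.

Lemma Cauchy_Schwarz x y : ⟨x, y⟩ <= `|x| * `|y|.
Proof.
have [->|x0] := eqVneq x 0; first by rewrite inner0l normr0 mul0r.
have [->|y0] := eqVneq y 0; first by rewrite inner0r normr0 mulr0.
have nx : 0 < `|x| by rewrite normr_gt0.
have ny : 0 < `|y| by rewrite normr_gt0.
have := sqr_ge0 `| `|y| *: x - `|x| *: y |.
rewrite sqr_normB innerZl innerZr !normrZ !normr_id !exprMn => h.
rewrite -(ler_pM2l (mulr_gt0 nx ny)).
by move: h; rewrite !expr2; lra.
Qed.

Lemma inner_bounded x y : `|⟨x, y⟩| <= `|x| * `|y|.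
Proof.
rewrite ler_norml Cauchy_Schwarz andbT lerNl -innerNl.
by rewrite (le_trans (Cauchy_Schwarz _ _))// normrN.
Qed.

Lemma inner_eq0 x : ⟨x, x⟩ = 0 -> x = 0.
Proof. by rewrite innerxx => /eqP; rewrite sqrf_eq0 normr_eq0 => /eqP. Qed.

Lemma norm_normalize x : x != 0 -> `| `|x|^-1 *: x| = 1.
Proof. by move=> x0; rewrite normrZ normfV normr_id mulVf ?normr_eq0. Qed.

End InnerProduct.

(** * Distance to a set *)

Section Distance.
Context {R : realType} {H : hilbertType R}.
Implicit Types (x c : H) (C : set H).

Lemma dist_ge x C (m : R) :
  C !=set0 -> (forall c, C c -> m <= `|x - c|) -> m <= dist x C.
Proof.
move=> [c Cc] mC; apply: lb_le_inf; first by exists `|x - c|, c.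
by move=> _ [d Cd <-]; exact: mC.
Qed.

Lemma dist_le x c C : C c -> dist x C <= `|x - c|.
Proof. by move=> Cc; apply: ge_inf; [exists 0 => _ [d _ <-] | exists c]. Qed.

Lemma dist_ge0 x C : C !=set0 -> 0 <= dist x C.
Proof. by move=> C0; exact: dist_ge. Qed.

Lemma dist_mem x C : C x -> dist x C = 0.
Proof.
move=> Cx; apply/eqP; rewrite eq_le dist_ge0 ?andbT; last by exists x.
by rewrite (le_trans (dist_le x Cx))// subrr normr0.
Qed.

End Distance.

(** * Orthogonal projection *)

Section Projection.
Context {R : realType} {H : hilbertType R}.
Implicit Types (x : H) (V : set H).

Definition subspace V := V 0 /\ forall (a : R) u v, V u -> V v -> V (a *: u + v).

Lemma subspaceZ V a u : subspace V -> V u -> V (a *: u).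
Proof. by move=> [V0 VD] Vu; rewrite -[_ *: _]addr0; exact: VD. Qed.

Lemma subspaceD V u v : subspace V -> V u -> V v -> V (u + v).
Proof. by move=> [V0 VD] Vu; rewrite -[u]scale1r; exact: VD. Qed.

(** The point [p] is the limit of a sequence in [V] minimizing the distance to
    [x], which is a Cauchy sequence by the parallelogram law. When [V] is
    closed, [p] is the orthogonal projection of [x] on [V]; the version with
    the closure also serves for the range of an adjoint. *)
Lemma orthogonal_projection V x : subspace V ->
  exists2 p, closure V p & orthogonal_complement V (x - p).
Proof.
move=> sV.
pose E := [set `|x - v| ^+ 2 | v in V].
have Vx (v : H) : V v -> inf E <= `|x - v| ^+ 2.
  move=> Vv; apply: ge_inf; last by exists v.
  by exists 0 => _ [w _ <-]; exact: sqr_ge0.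
have infE : has_inf E.
  split; first by exists (`|x - 0| ^+ 2), 0 => //; exact: sV.1.
  by exists 0 => _ [w _ <-]; exact: sqr_ge0.
have /choice[v vP] : forall n : nat,
    exists v, V v /\ `|x - v| ^+ 2 < inf E + n.+1%:R^-1.
  move=> n; have [|_ [v Vv <-] vn] := @inf_adherent _ E n.+1%:R^-1 _ infE.
    by rewrite invr_gt0.
  by exists v.
(* Parallelogram law for [x - v n] and [x - v m], whose half sum is [x] minus
   the midpoint of [v n] and [v m], a point of [V]. *)
have gap n m : `|v n - v m| ^+ 2 <= 2 * n.+1%:R^-1 + 2 * m.+1%:R^-1.
  have := parallelogram (x - v n) (x - v m).
  have -> : x - v n - (x - v m) = v m - v n by rewrite opprB addrC addrA subrK.
  have -> : x - v n + (x - v m) = 2 *: (x - 2^-1 *: (v n + v m)).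
    rewrite scalerBr scalerA divff ?pnatr_eq0// scale1r scaler_nat mulr2n.
    by rewrite opprD addrACA.
  rewrite normrZ exprMn (ger0_norm (ler0n _ 2)) (distrC (v m)) => pl.
  have := Vx (2^-1 *: (v n + v m)).
  move=> /(_ (subspaceZ _ sV (subspaceD sV (vP n).1 (vP m).1))).
  have := (vP n).2; have := (vP m).2.
  move: (inf E) n.+1%:R^-1 m.+1%:R^-1 (`|v n - v m| ^+ 2) (`|x - _ *: _| ^+ 2)
    (`|x - v n| ^+ 2) (`|x - v m| ^+ 2) pl.
  by move=> c a b d e f g; lra.
have /cauchy_cvgP : cauchy (v @ \oo).
  apply: cauchy_exP => e e0.
  have e4 : 0 < e ^+ 2 / 4 by rewrite divr_gt0 ?exprn_gt0.
  have [N _ /(_ N (leqnn N)) /= hN] := near_infty_natSinv_lt (PosNum e4).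
  exists (v N); exists N => // n /= Nn.
  rewrite -ball_normE /=.
  rewrite -(@ltr_pXn2r _ 2%N)// ?nnegrE ?(ltW e0)//.
  apply: le_lt_trans (gap N n) _.
  have : n.+1%:R^-1 <= N.+1%:R^-1 :> R by rewrite lef_pV2 ?posrE// ler_nat.
  by move: hN => /=; move: n.+1%:R^-1 N.+1%:R^-1 => a b; lra.
set p := lim (v @ \oo) => vp; exists p.
  apply: closed_cvg vp; first exact: closed_closure.
  by apply: nearW => n; apply: subset_closure; exact: (vP n).1.
have Vp (w : H) : V w -> inf E <= `|x - p - w| ^+ 2.
  move=> Vw.
  have cw : `|x - v n - w| ^+ 2 @[n --> \oo] --> `|x - p - w| ^+ 2.
    have c1 : `|x - v n - w| @[n --> \oo] --> `|x - p - w|.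
      apply: cvg_norm; apply: cvgB; last exact: cvg_cst.
      by apply: cvgB; [exact: cvg_cst | exact: vp].
    rewrite expr2; under eq_fun do rewrite expr2; exact: cvgM.
  apply: (cvgr_to_ge cw); apply: nearW => n.
  by rewrite -addrA -opprD; apply: Vx; apply: subspaceD sV (vP n).1 Vw.
have pE : `|x - p| ^+ 2 <= inf E.
  have cw : `|x - v n| ^+ 2 - n.+1%:R^-1 @[n --> \oo] --> `|x - p| ^+ 2 - 0.
    apply: cvgB; last exact: cvg_harmonic.
    have c1 : `|x - v n| @[n --> \oo] --> `|x - p|.
      by apply: cvg_norm; apply: cvgB; [exact: cvg_cst | exact: vp].
    rewrite expr2; under eq_fun do rewrite expr2; exact: cvgM.
  rewrite subr0 in cw.
  apply: (cvgr_to_le cw); apply: nearW => n.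
  by rewrite lerBlDr; apply: ltW; exact: (vP n).2.
(* First variation at the minimizer [p], in the direction [w]: the step
   [s * c] is small enough for the linear term [- 2 * s * c ^+ 2] to outweigh
   the quadratic one, unless [c = 0]. *)
move=> w Vw; set c := ⟨_, _⟩.
pose s := (1 + `|w| ^+ 2)^-1.
have w1 : 0 < 1 + `|w| ^+ 2 by rewrite ltr_pwDl ?sqr_ge0.
have s0 : 0 < s by rewrite invr_gt0.
have := le_trans pE (Vp _ (subspaceZ (s * c) sV Vw)).
rewrite [leRHS]sqr_normB normrZ innerZr -/c exprMn real_normK ?num_real// => h.
have sw : s * `|w| ^+ 2 <= 1.
  by rewrite -(mulVf (lt0r_neq0 w1)) ler_pM2l// lerDr.
have : s * c ^+ 2 <= 0.
  have : s * c ^+ 2 * (s * `|w| ^+ 2) <= s * c ^+ 2 * 1.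
    by apply: ler_wpM2l => //; rewrite mulr_ge0 ?sqr_ge0 ?ltW.
  by move: h; lra.
rewrite pmulr_rle0// => c2; apply/eqP; rewrite -sqrf_eq0.
by rewrite eq_le c2 sqr_ge0.
Qed.

(** Passage to the limit in quantitative form: this is how a property of [V]
    is carried over to its closure in the proofs below. *)
Lemma closure_le0 (V : set H) p (g C : R) :
  closure V p -> (forall v, V v -> g <= C * `|p - v|) -> g <= 0.
Proof.
move=> pV gC; apply/ler_addgt0Pl => e e0; rewrite addr0.
have C1 : 0 < 1 + `|C| by rewrite ltr_pwDl.
have [|v [Vv]] := pV (ball p (e / (1 + `|C|))).
  by apply: nbhsx_ballx; rewrite divr_gt0.
rewrite -ball_normE /= ltr_pdivlMr// => pv.
rewrite (le_trans (gC _ Vv))// (le_trans _ (ltW pv))//.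
by rewrite mulrC ler_wpM2l// (le_trans (ler_norm C))// lerDr.
Qed.

Lemma orthogonal_closure (V : set H) z p :
  orthogonal_complement V z -> closure V p -> ⟨z, p⟩ = 0.
Proof.
move=> zV pV; apply/eqP; rewrite -normr_le0.
apply: (@closure_le0 V p _ `|z|) => // v /zV zv.
by rewrite -[⟨z, p⟩]subr0 -zv -innerBr inner_bounded.
Qed.

End Projection.

(** * Riesz representation and weak boundedness *)

Section Duality.
Context {R : realType} {H : hilbertType R}.

(** If [f] is not zero, its kernel is a hyperplane, and [f] is the inner product
    with a multiple of any nonzero vector [q] orthogonal to that hyperplane. *)
Lemma Riesz_representation (f : H -> R) (C : R) :
  (forall a u v, f (a *: u + v) = a * f u + f v) ->
  (forall u, `|f u| <= C * `|u|) ->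
  exists v, forall u, f u = ⟨u, v⟩.
Proof.
move=> flin fC.
have f0 : f 0 = 0.
  by have := flin (-1) 0 0; rewrite scaler0 addr0 mulN1r addNr.
have fZ a u : f (a *: u) = a * f u by rewrite -[_ *: _]addr0 flin f0 addr0.
have fB u v : f (u - v) = f u - f v by rewrite addrC -scaleN1r flin mulN1r addrC.
have [[x fx]|/forallNP f_eq0] := pselect (exists x, f x <> 0); last first.
  by exists 0 => u; rewrite inner0r; exact: (contrapT (f_eq0 u)).
have sub_ker : subspace [set u | f u = 0].
  by split=> //= a u v fu fv; rewrite flin fu fv mulr0 addr0.
have [p pV xp] := orthogonal_projection x sub_ker.
have fp : f p = 0.
  apply/eqP; rewrite -normr_le0.
  apply: (closure_le0 (C := C) pV) => v fv.
  by rewrite -[f p]subr0 -fv -fB.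
set q := x - p in xp.
have fq : f q = f x by rewrite fB fp subr0.
have q0 : ⟨q, q⟩ != 0.
  apply/eqP => /inner_eq0 q0; apply: fx.
  by rewrite -fq q0.
exists ((f q / ⟨q, q⟩) *: q) => u.
have /xp : f (u - (f u / f q) *: q) = 0.
  by rewrite fB fZ fq divfK ?subrr//; exact/eqP.
rewrite innerBr innerZr innerZr (innerC u) => /eqP.
rewrite subr_eq0 => /eqP ->.
rewrite fq; field.
by apply/andP; split; [exact/eqP | exact: q0].
Qed.

(** The Banach-Steinhaus theorem for the functionals [⟨b, _⟩]. Bounds
    from above suffice, since they hold at [y] and at [- y]. *)
Lemma weakly_bounded_norm_bounded (B : set H) :
  (forall y, exists M : R, forall b, B b -> ⟨b, y⟩ <= M) ->
  exists M : R, forall b, B b -> `|b| <= M.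
Proof.
move=> wB.
pose F : set (H -> R^o) := [set (fun y => ⟨b, y⟩) | b in B].
have [||M MF] := @Banach_Steinhauss R H R^o F _ _ 1.
- move=> _ [b Bb <-]; split=> [r|a u v]; last by rewrite innerDr innerZr.
  exists (`|b| * r) => u ur.
  by rewrite (le_trans (inner_bounded _ _))// ler_wpM2l.
- move=> y; have [M1 hM1] := wB y; have [M2 hM2] := wB (- y).
  exists (Num.max M1 M2) => _ [b Bb <-] /=.
  rewrite ler_norml le_max hM1// orTb andbT lerNl le_max.
  by rewrite -innerNr hM2 ?orbT.
exists M => b Bb.
have [->|b0] := eqVneq b 0.
  rewrite normr0 -(normr0 R^o).
  apply: (le_trans _ (MF _ (ex_intro2 _ _ b Bb erefl) 0 _)); last first.
    by rewrite normr0.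
  by rewrite /= normr0.
have nb : `|b| != 0 by rewrite normr_eq0.
(* The functional attached to [b] takes the value [`|b|] at [b / `|b|]. *)
have := MF _ (ex_intro2 _ _ b Bb erefl) (`|b|^-1 *: b).
rewrite norm_normalize// => /(_ (lexx _)).
by rewrite innerZr innerxx expr2 mulKf// normr_id.
Qed.

Lemma weak_cvg_bounded (x : nat -> H) (l : H) :
  weak_cvg x l -> exists M : R, forall n, `|x n| <= M.
Proof.
move=> xl.
have [|M hM] := @weakly_bounded_norm_bounded (range x).
  move=> y; have /cvg_seq_bounded : cvgn (fun n => ⟨x n, y⟩ : R^o).
    by apply/cvg_ex; exists ⟨l, y⟩; exact: xl.
  move=> [M [_ hM]]; exists (M + 1) => _ [n _ <-].
  by apply: le_trans (ler_norm _) _; apply: (hM (M + 1)) => //; rewrite ltrDl.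
by exists M => n; apply: hM; exists n.
Qed.

End Duality.

(** * Bounded operators and their adjoints *)

Section BoundedOperator.
Context {R : realType} {H1 H2 : hilbertType R}.
Variable A : {linear H1 -> H2}.
Hypothesis A_bounded : bounded_fun_norm A.

Lemma opnorm_bound x : `|A x| <= opnorm A * `|x|.
Proof.
have [M AM] := A_bounded 1.
have [->|x0] := eqVneq x 0; first by rewrite linear0 !normr0 mulr0.
have nx : 0 < `|x| by rewrite normr_gt0.
rewrite -ler_pdivrMr// mulrC.
have -> : `|x|^-1 * `|A x| = `|A (`|x|^-1 *: x)|.
  by rewrite linearZ normrZ normfV normr_id.
apply: ub_le_sup; first by exists M => _ [u u1 <-]; exact: AM.
exists (`|x|^-1 *: x) => //=.
by rewrite norm_normalize.
Qed.

Lemma opnorm_gt0 : (exists x, A x != 0) -> 0 < opnorm A.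
Proof.
move=> [x Ax]; have := opnorm_bound x; apply: contraTT.
rewrite -leNgt -ltNge => le0.
by rewrite (@le_lt_trans _ _ 0) ?normr_gt0// mulr_le0_ge0.
Qed.

(** By Riesz representation, the choice made in [adjoint] is not the default
    value. *)
Lemma adjointE x y : ⟨A x, y⟩ = ⟨x, adjoint A y⟩.
Proof.
have [||v hv] := @Riesz_representation _ _ (fun x => ⟨A x, y⟩) (opnorm A * `|y|).
- by move=> a u v; rewrite linearP innerDl innerZl.
- move=> u; rewrite (le_trans (inner_bounded _ _))// mulrAC.
  by rewrite ler_wpM2r// opnorm_bound.
have := @xgetPex _ 0 [set v : H1 | forall x, ⟨A x, y⟩ = ⟨x, v⟩].
by move=> /(_ (ex_intro _ v hv)); exact.
Qed.

Lemma adjoint0 : adjoint A 0 = 0.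
Proof. by apply: inner_eq0; rewrite -adjointE inner0r. Qed.

Lemma adjointP a y z : adjoint A (a *: y + z) = a *: adjoint A y + adjoint A z.
Proof.
apply/eqP; rewrite -subr_eq0; apply/eqP; apply: inner_eq0.
by rewrite innerBr innerDr innerZr -!adjointE innerDr innerZr subrr.
Qed.

Lemma adjointZ a y : adjoint A (a *: y) = a *: adjoint A y.
Proof. by rewrite -[a *: y]addr0 adjointP adjoint0 addr0. Qed.

Lemma subspace_ker : subspace (ker A).
Proof.
by split=> [|a u v /= Au Av];
  rewrite /ker /= ?linear0// linearP Au Av scaler0 addr0.
Qed.

Lemma subspace_range : subspace (range A).
Proof.
split; first by exists 0; rewrite ?linear0.
by move=> a _ _ [u _ <-] [v _ <-]; exists (a *: u + v); rewrite ?linearP.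
Qed.

Lemma closed_ker : closed (ker A).
Proof.
move=> p pK; rewrite /ker /=; apply/eqP; rewrite -normr_le0.
apply: (closure_le0 (C := opnorm A) pK) => v Av.
by rewrite -[A p]subr0 -Av -linearB opnorm_bound.
Qed.

End BoundedOperator.

(** * Operators with closed range *)

Section ClosedRange.
Context {R : realType} {H1 H2 : hilbertType R}.
Variable A : {linear H1 -> H2}.
Hypothesis A_bounded : bounded_fun_norm A.

(** Uniform boundedness for the [u] in [range A] with [`|adjoint A u| <= 1]:
    by projection on the closed subspace [range A], testing such [u] against an
    arbitrary [y] amounts to testing them against some [A x], and
    [⟨u, A x⟩ = ⟨adjoint A u, x⟩ <= `|x|]. *)
Lemma adjoint_bounded_below : closed (range A) ->
  exists2 M : R, 0 < M & forall u, range A u -> `|u| <= M * `|adjoint A u|.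
Proof.
move=> cA.
pose B := [set u | range A u /\ `|adjoint A u| <= 1].
have [|M hM] := @weakly_bounded_norm_bounded R H2 B.
  move=> y; have [p /cA [x _ Axp] yp] := orthogonal_projection y (subspace_range A).
  exists `|x| => u [Au u1].
  rewrite -[y](subrK p) innerDr innerC (yp _ Au) add0r -Axp innerC adjointE//.
  by rewrite (le_trans (Cauchy_Schwarz _ _))// ler_piMr.
have M0 : 0 < 1 + `|M| by rewrite ltr_pwDl.
exists (1 + `|M|) => // u Au.
have [a0|a0] := eqVneq (adjoint A u) 0.
  rewrite a0 normr0 mulr0.
  case: Au => x _ Ax.
  have : ⟨u, u⟩ = 0 by rewrite -{1}Ax adjointE// a0 inner0r.
  by rewrite innerxx => /eqP; rewrite sqrf_eq0 => /eqP ->.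
have na : 0 < `|adjoint A u| by rewrite normr_gt0.
have /hM : B (`|adjoint A u|^-1 *: u).
  split; first exact: subspaceZ (subspace_range A) Au.
  by rewrite adjointZ// normrZ normfV normr_id mulVf ?gt_eqF.
rewrite normrZ normfV normr_id ler_pdivrMl// => /le_trans; apply.
by rewrite mulrC ler_wpM2r// (le_trans (ler_norm _))// lerDr.
Qed.

(** A vector [x] orthogonal to [ker A] is a limit of vectors [adjoint A u]
    with [u] in [range A].
    If it is equal to one of them, then [`|x| ^+ 2 = ⟨A x, u⟩ <= `|A x| * `|u|]
    with [`|u| <= M * `|x|], whence the constant [M^-1]; in general there is
    an error term proportional to [`|x - adjoint A u|]. *)
Lemma bounded_below : closed (range A) ->
  exists2 c : R, 0 < c &
    forall x, orthogonal_complement (ker A) x -> c * `|x| <= `|A x|.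
Proof.
move=> cA; have [M M0 hM] := adjoint_bounded_below cA.
exists M^-1; first by rewrite invr_gt0.
move=> x xK; rewrite ler_pdivrMl//.
pose V := [set adjoint A u | u in range A].
have sV : subspace V.
  split; first by exists 0; [exact: (subspace_range A).1 | exact: adjoint0].
  move=> a _ _ [u Au <-] [v Av <-]; exists (a *: u + v); last exact: adjointP.
  exact: (subspace_range A).2.
(* The component [x - p] of [x] orthogonal to the range of the adjoint lies in
   [ker A], to which [x] is orthogonal. *)
have [p pV xp] := orthogonal_projection x sV.
have Ker : ker A (x - p).
  apply: inner_eq0; rewrite adjointE//; apply: xp.
  by exists (A (x - p)) => //; exists (x - p).
have Kp : ⟨x - p, p⟩ = 0 by exact: orthogonal_closure xp pV.
have xpE : x = p.
  apply/eqP; rewrite -subr_eq0; apply/eqP; apply: inner_eq0.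
  by rewrite innerBr innerC xK// Kp subrr.
rewrite -{}xpE {p xp Ker Kp} in pV.
have [->|x0] := eqVneq x 0; first by rewrite linear0 !normr0 mulr0.
have nx : 0 < `|x| by rewrite normr_gt0.
rewrite -(ler_pM2r nx) -expr2 -subr_le0.
apply: (closure_le0 (C := `|x| + M * `|A x|) pV) => _ [u Au <-].
set d := `|x - _|.
have xx : `|x| ^+ 2 <= `|x| * d + `|A x| * (M * `|adjoint A u|).
  rewrite -innerxx -{2}[x](subrK (adjoint A u)) innerDr lerD ?Cauchy_Schwarz//.
  by rewrite -adjointE// (le_trans (Cauchy_Schwarz _ _))// ler_wpM2l// hM.
have ux : `|adjoint A u| <= `|x| + d.
  by rewrite -lerBlDl (le_trans (lerB_dist _ _))// distrC.
have := ler_wpM2l (mulr_ge0 (ltW M0) (normr_ge0 (A x))) ux.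
by move: xx; rewrite expr2; lra.
Qed.

Lemma unit_vector_orthogonal_ker : (exists x, A x != 0) ->
  exists2 x, orthogonal_complement (ker A) x & `|x| = 1.
Proof.
move=> [x Ax]; have [p pK xp] := orthogonal_projection x (subspace_ker A).
have {}pK : ker A p by exact: closed_ker.
have nq : x - p != 0.
  rewrite subr_eq0; apply: contraNneq Ax => ->.
  exact/eqP.
exists (`|x - p|^-1 *: (x - p)).
  by move=> v Kv; rewrite innerZl xp// mulr0.
exact: norm_normalize.
Qed.

Lemma min_modulus_bound x :
  orthogonal_complement (ker A) x -> min_modulus A * `|x| <= `|A x|.
Proof.
move=> xK; have [->|x0] := eqVneq x 0; first by rewrite linear0 !normr0 mulr0.
have nx : 0 < `|x| by rewrite normr_gt0.
rewrite -ler_pdivlMr// mulrC.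
have -> : `|x|^-1 * `|A x| = `|A (`|x|^-1 *: x)|.
  by rewrite linearZ normrZ normfV normr_id.
apply: ge_inf; first by exists 0 => _ [u _ <-].
exists (`|x|^-1 *: x) => //; split; last first.
  exact: norm_normalize.
by move=> v Kv; rewrite innerZl xK// mulr0.
Qed.

Lemma min_modulus_gt0 : (exists x, A x != 0) -> closed (range A) ->
  0 < min_modulus A.
Proof.
move=> A0 cA; have [c c0 hc] := bounded_below cA.
apply: lt_le_trans c0 _; apply: lb_le_inf.
  by have [x xK x1] := unit_vector_orthogonal_ker A0; exists `|A x|, x.
move=> _ [x [xK x1] <-].
by rewrite -[c]mulr1 -{1}x1; exact: hc.
Qed.

(** The infimum that defines [min_modulus] is over the empty set when [A = 0];
    it is then 0. *)
Lemma min_modulus_ge0 : 0 <= min_modulus A.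
Proof.
rewrite /min_modulus; set E := [set _ | _ in _].
have [->|/set0P ne] := eqVneq E set0; first by rewrite inf0.
by apply: lb_le_inf => // _ [u _ <-].
Qed.

(** Given [A w] in [Q], let [p] be the component of [x - w] in [ker A]. Then
    [w + p] has the same image as [w], and [x - (w + p)] is orthogonal to
    [ker A], where [A] shrinks norms at most by the factor [min_modulus A]. *)
Lemma dist_preimage x (Q : set H2) : range A `&` Q !=set0 ->
  min_modulus A * dist x (A @^-1` Q) <= dist (A x) (range A `&` Q).
Proof.
move=> ne; apply: dist_ge => // _ [[w _ <-] Qw].
have [p pK xp] := orthogonal_projection (x - w) (subspace_ker A).
have {}pK : ker A p by exact: closed_ker.
have Ap : A (x - w - p) = A x - A w by rewrite !linearB pK subr0.
rewrite -Ap (le_trans _ (min_modulus_bound xp))// ler_wpM2l ?min_modulus_ge0//.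
rewrite -addrA -opprD; apply: dist_le.
by rewrite /= linearD pK addr0.
Qed.

End ClosedRange.

(** * Landweber operators *)

Lemma cvg0_sqr (R : realType) (u v : nat -> R) : (forall k, u k ^+ 2 <= v k) ->
  v k @[k --> \oo] --> (0 : R) -> u k @[k --> \oo] --> (0 : R).
Proof.
move=> uv v0; apply/cvgr0Pnorm_lt => e e0.
have e2 : 0 < e ^+ 2 by rewrite exprn_gt0.
move/cvgr0Pnorm_lt : v0 => /(_ _ e2); apply: filterS => k vk.
rewrite -(@ltr_pXn2r _ 2%N)// ?nnegrE ?(ltW e0)// real_normK ?num_real//.
exact: le_lt_trans (uv k) (le_lt_trans (ler_norm _) vk).
Qed.

(** The form in which strong quasi-nonexpansiveness is used: it is what remains
    of the defining inequality after expanding the square of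
    [T u - z = (T u - u) - (z - u)]. *)
Lemma SQNE_inner (R : realType) (H : hilbertType R) (T : H -> H) (rho : R) u z :
  SQNE rho T -> Fix T z ->
  (rho + 1) / 2 * `|T u - u| ^+ 2 <= ⟨T u - u, z - u⟩.
Proof.
move=> T_SQNE /(T_SQNE.2 u).
have -> : T u - z = (T u - u) - (z - u) by rewrite opprB addrA subrK.
rewrite (distrC u z) sqr_normB => h.
by rewrite -subr_ge0; move: h; lra.
Qed.

Section Landweber.
Context {R : realType} {H1 H2 : hilbertType R}.
Variables (A : {linear H1 -> H2}) (T : H2 -> H2) (rho : R).
Hypotheses (A_bounded : bounded_fun_norm A) (A_neq0 : exists x, A x != 0).
Hypotheses (rho_ge0 : 0 <= rho) (T_SQNE : SQNE rho T).
Hypothesis imA_FixT : range A `&` Fix T !=set0.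

Lemma landweber_inner x w : Fix T (A w) ->
  (rho + 1) / 2 * `|T (A x) - A x| ^+ 2 <=
    opnorm A ^+ 2 * ⟨landweber A T x - x, w - x⟩.
Proof.
move=> /(SQNE_inner (A x) T_SQNE)/le_trans; apply.
rewrite /landweber [x + _]addrC addrK innerZl mulVKf.
  by rewrite innerC -linearB adjointE// innerC.
by rewrite expf_neq0// gt_eqF// opnorm_gt0.
Qed.

(** At a fixed point [x], [landweber_inner] bounds the squared residual
    [`|T (A x) - A x| ^+ 2] by 0. *)
Lemma Fix_landweber : Fix (landweber A T) = A @^-1` Fix T.
Proof.
apply/seteqP; split=> x; rewrite /Fix /= => xF.
  have [_ [[w _ <-] /(landweber_inner x)]] := imA_FixT.
  rewrite xF subrr inner0l mulr0 pmulr_rle0; last by rewrite divr_gt0// ltr_wpDl.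
  by rewrite exprn_even_le0//= normr_eq0 subr_eq0 => /eqP.
by rewrite /landweber xF subrr adjoint0// scaler0 addr0.
Qed.

Lemma Fix_landweber_neq0 : Fix (landweber A T) !=set0.
Proof.
by rewrite Fix_landweber; have [_ [[w _ <-] Tw]] := imA_FixT; exists w.
Qed.

Lemma residual_le_norm x w : Fix T (A w) ->
  (rho + 1) / 2 * `|T (A x) - A x| ^+ 2 <=
    opnorm A ^+ 2 * `|landweber A T x - x| * `|x - w|.
Proof.
move=> /(landweber_inner x)/le_trans; apply.
by rewrite -mulrA ler_wpM2l ?sqr_ge0// (distrC x) Cauchy_Schwarz.
Qed.

(** Infimum of [residual_le_norm] over [w]. *)
Lemma residual_le_dist x :
  (rho + 1) / 2 * `|T (A x) - A x| ^+ 2 <=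
    opnorm A ^+ 2 * `|landweber A T x - x| * dist x (Fix (landweber A T)).
Proof.
have ne := Fix_landweber_neq0.
have := mulr_ge0 (sqr_ge0 (opnorm A)) (normr_ge0 (landweber A T x - x)).
rewrite le_eqVlt => /predU1P[c0|c0].
  case: ne => w; rewrite Fix_landweber => /(residual_le_norm x).
  by rewrite -c0 !mul0r.
rewrite -ler_pdivrMl//; apply: dist_ge => // w.
by rewrite ler_pdivrMl// Fix_landweber; exact: residual_le_norm.
Qed.

Lemma residual_cvg0 (x : nat -> H1) (M : R) :
  (forall k, dist (x k) (Fix (landweber A T)) <= M) ->
  `|landweber A T (x k) - x k| @[k --> \oo] --> (0 : R) ->
  `|T (A (x k)) - A (x k)| @[k --> \oo] --> (0 : R).
Proof.
move=> xM Lx.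
have r0 : 0 < (rho + 1) / 2 by rewrite divr_gt0// ltr_wpDl.
pose c := ((rho + 1) / 2)^-1 * (opnorm A ^+ 2 * M).
apply: (cvg0_sqr (v := fun k => c * `|landweber A T (x k) - x k|)); last first.
  by rewrite -(mulr0 c); apply: cvgM => //; exact: cvg_cst.
move=> k; rewrite /c -mulrA ler_pdivlMl// (le_trans (residual_le_dist _))//.
by rewrite mulrAC ler_wpM2r// ler_wpM2l ?sqr_ge0.
Qed.

Lemma bigcap_range_Fix :
  \bigcap_i tnth [tuple range A; Fix T] i = range A `&` Fix T.
Proof.
apply/seteqP; split=> [y h|y [Ay Ty] i _].
  by split; [exact: (h ord0) | exact: (h (lift ord0 ord0))].
by case: (unliftP ord0 i) => [j ->|->//]; rewrite (ord1 j).
Qed.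

(** As [A x] lies in [range A], the maximum is the distance to [Fix T]. *)
Lemma max_dist_range_Fix x :
  max_dist (A x) (tnth [tuple range A; Fix T]) = dist (A x) (Fix T).
Proof.
rewrite /max_dist !big_ord_recl big_ord0 !(tnth_nth set0)/=.
have -> : dist (A x) (range A) = 0 by apply: dist_mem; exists x.
by rewrite (max_idPl (dist_ge0 _ T_SQNE.1)) (max_idPr (dist_ge0 _ T_SQNE.1)).
Qed.

Lemma dist_Fix_landweber x :
  min_modulus A * dist x (Fix (landweber A T)) <=
    dist (A x) (\bigcap_i tnth [tuple range A; Fix T] i).
Proof. by rewrite Fix_landweber bigcap_range_Fix; exact: dist_preimage. Qed.

Variable S : set H2.

Lemma weakly_regular_landweber : weakly_regular T S ->
  weakly_regular (landweber A T) (A @^-1` S).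
Proof.
move=> [_ Treg]; split; first exact: Fix_landweber_neq0.
move=> x n xoo xS n_incr xn Lx; rewrite Fix_landweber /=.
(* [T] is tested on the image of the subsequence itself, since the residuals of
   the full sequence need not vanish. *)
apply: (Treg (A \o x \o n) id) => //.
- by move=> k; exact: xS.
- move=> y; rewrite /= adjointE//; under eq_fun do rewrite /= adjointE//.
  exact: xn.
have [M hM] := weak_cvg_bounded xn.
have n_ge k : (k <= n k)%N.
  by elim: k => // k /leq_ltn_trans; apply; exact: n_incr.
have n_oo : n @ \oo --> \oo.
  move=> P [N _ NP]; exists N => // k /= Nk; apply: NP => /=.
  exact: leq_trans Nk (n_ge k).
have [w Lw] := Fix_landweber_neq0.
apply/norm_cvg0P.
apply: (@residual_cvg0 (x \o n) (M + `|w|)).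
  by move=> k; rewrite (le_trans (dist_le _ Lw))// (le_trans (ler_normB _ _))//
    lerD2r.
have /norm_cvg0P Lxn := cvg_comp _ _ n_oo Lx.
exact: Lxn.
Qed.

Lemma regular_landweber : closed (range A) -> regular T S -> bounded_set S ->
  regular_family (tnth [tuple range A; Fix T]) S ->
  regular (landweber A T) (A @^-1` S).
Proof.
move=> cA [_ Treg] [M [_ SM]] [_ Creg]; split; first exact: Fix_landweber_neq0.
move=> x xS Lx.
have mA := min_modulus_gt0 A_bounded A_neq0 cA.
have dx k : dist (x k) (Fix (landweber A T)) <=
    (min_modulus A)^-1 * dist (A (x k)) (\bigcap_i tnth [tuple range A; Fix T] i).
  by rewrite ler_pdivlMl//; exact: dist_Fix_landweber.
have dA : dist (A (x k)) (\bigcap_i tnth [tuple range A; Fix T] i)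
    @[k --> \oo] --> (0 : R).
  apply: (Creg (A \o x)) => //; under eq_fun do rewrite max_dist_range_Fix.
  apply: (Treg (A \o x)) => //.
  have [z zC] := imA_FixT.
  apply: (@residual_cvg0 x ((min_modulus A)^-1 * (M + 1 + `|z|))) => // k.
  rewrite (le_trans (dx k))// ler_wpM2l ?invr_ge0 ?(ltW mA)//.
  rewrite bigcap_range_Fix (le_trans (dist_le _ zC))//.
  rewrite (le_trans (ler_normB _ _))// lerD2r.
  by apply: (SM (M + 1)); [rewrite ltrDl | exact: xS].
apply: (squeeze_cvgr _ (cvg_cst 0)); last first.
  rewrite -(mulr0 (min_modulus A)^-1); apply: cvgM dA; exact: cvg_cst.
apply: nearW => k; rewrite dx andbT dist_ge0//; exact: Fix_landweber_neq0.
Qed.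

(** With [d] for the distance from [x] to the fixed point set, regularity of
    [T], regularity of the family and [dist_preimage] bound the residual below by
    [delta * min_modulus A / kappa * d]. In [residual_le_dist] this yields
    [d ^+ 2] on the left and [d] on the right. *)
Lemma linearly_regular_landweber (delta kappa : R) :
  closed (range A) -> linearly_regular T S delta ->
  linearly_regular_family (tnth [tuple range A; Fix T]) S kappa ->
  linearly_regular (landweber A T) (A @^-1` S)
    ((rho + 1) / 2 * (delta * min_modulus A / (kappa * opnorm A)) ^+ 2).
Proof.
move=> cA [_ delta0 Treg] [_ kappa0 Creg].
have mA := min_modulus_gt0 A_bounded A_neq0 cA.
have NA := opnorm_gt0 A_bounded A_neq0.
have r0 : 0 < (rho + 1) / 2 by rewrite divr_gt0// ltr_wpDl.
split; first exact: Fix_landweber_neq0.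
  by rewrite mulr_gt0// exprn_gt0// divr_gt0 ?mulr_gt0.
move=> x Sx.
have := dist_ge0 x Fix_landweber_neq0.
rewrite le_eqVlt => /predU1P[<-|]; first by rewrite mulr0.
have := residual_le_dist x; have := dist_Fix_landweber x.
set d := dist x _ => mdC res d0.
have res_ge : delta * min_modulus A / kappa * d <= `|T (A x) - A x|.
  apply: le_trans (Treg _ Sx); rewrite -!mulrA ler_pM2l// mulrCA ler_pdivrMl//.
  by rewrite (le_trans mdC)// -max_dist_range_Fix Creg.
rewrite -(ler_pM2r d0) -(ler_pM2l (exprn_gt0 2 NA)) mulrA.
rewrite mulrA in res *.
apply: le_trans res.
have -> : opnorm A ^+ 2 * ((rho + 1) / 2 *
    (delta * min_modulus A / (kappa * opnorm A)) ^+ 2 * d) * d =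
    (rho + 1) / 2 * (delta * min_modulus A / kappa * d) ^+ 2.
  by field; rewrite !gt_eqF.
rewrite ler_pM2l// ler_pXn2r// nnegrE//.
by rewrite !mulr_ge0 ?invr_ge0 ?(ltW mA) ?(ltW d0) ?(ltW kappa0) ?(ltW delta0).
Qed.

End Landweber.

Theorem theorem4p7 (R : realType) (H1 H2 : hilbertType R)
    (A : {linear H1 -> H2}) (T : H2 -> H2) (rho : R) (S : set H2)
    (A_bounded : bounded_fun_norm A) (A_neq0 : exists x, A x != 0)
    (rho_ge0 : 0 <= rho) (T_SQNE : SQNE rho T) (S_neq0 : S !=set0)
    (imA_FixT : range A `&` Fix T !=set0) :
  [/\ weakly_regular T S ->
        weakly_regular (landweber A T) (A @^-1` S),
      closed (range A) -> regular T S -> bounded_set S ->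
        regular_family (tnth [tuple range A; Fix T]) S ->
        regular (landweber A T) (A @^-1` S) &
      forall delta kappa : R,
        closed (range A) -> linearly_regular T S delta ->
        linearly_regular_family (tnth [tuple range A; Fix T]) S kappa ->
        linearly_regular (landweber A T) (A @^-1` S)
          ((rho + 1) / 2 *
           (delta * min_modulus A / (kappa * opnorm A)) ^+ 2)].
Proof.
split.
- exact: (weakly_regular_landweber A_bounded A_neq0 rho_ge0 T_SQNE imA_FixT).
- exact: (regular_landweber A_bounded A_neq0 rho_ge0 T_SQNE imA_FixT).
- exact: (linearly_regular_landweber A_bounded A_neq0 rho_ge0 T_SQNE imA_FixT).
Qed.
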